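(* Let $A\in\mathbb{R}^{m\times n}$ with $m\le n$, let $x\in\mathbb{R}^n$ and $b\in\mathbb{R}^m$, $b\neq 0$, satisfy $Ax=b$, and let $\bar{x}$ be the orthogonal projection of $x$ onto $\operatorname{ran}(A')$. Let $\{x_s\}_{s=1}^{t}$ be an initial segment of the sequence of approximating vectors produced by the SAP process before convergence is reached, i.e. $x_s\neq\bar{x}$ for $s=1,\dots,t$. Then $$\|x_1\|<\|x_2\|<\cdots<\|x_t\|<\|\bar{x}\|.$$
   Context: Notation: $A'$ denotes the transpose of $A$, $\operatorname{ran}(M)$ the column space of $M$, and $\|\cdot\|$ the Euclidean norm. Row blocks: the rows of $A$ are divided into $k$ blocks $A_1,\dots,A_k$ (each $A_i$ is a submatrix of $A$ consisting of some of its rows; different blocks may share rows; every row of $A$ lies in at least one block), and $b_1,\dots,b_k$ are the corresponding subvectors of $b$, so $A_ix=b_i$. One AP (accumulated projection) sweep started from a vector $p_0$: for $i=1,\dots,k$ let $W_i=[p_{i-1},A_i']$ and let $p_i$ be the orthogonal projection of $x$ onto $\operatorname{ran}(W_i)$ (so $p_i=W_i(W_i'W_i)^{-1}W_i'x$ when $W_i$ has full column rank). The output of the sweep is $p_k$. SAP (stationary accumulated projection) process: $x_0=\alpha A'b$ with $\alpha=\|b\|^2/\|A'b\|^2$, and for $s=0,1,2,\dots$ the vector $x_{s+1}$ is the output of one AP sweep started from $p_0=x_s$. *)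

(* Defs.v *)
From HB Require Import structures.
From mathcomp Require Import all_boot all_order all_algebra.
From mathcomp Require Import reals.
Set Implicit Arguments.
Unset Strict Implicit.
Unset Printing Implicit Defensive.
Import Order.TTheory GRing.Theory Num.Theory.
Local Open Scope ring_scope.

(* MathComp-Analysis puts the sup norm on matrices, hence a separate name. *)
Definition enorm (R : realType) (n : nat) (v : 'cV[R]_n) : R :=
  Num.sqrt (\sum_(i < n) v i 0 ^+ 2).

(* MathComp's subspaces are row spaces and proj_mx acts on row vectors, hence
   the transposes: the row space of W^T is ran(W), and the row space of kermx W
   is the orthogonal complement of ran(W). *)
Definition orthproj (R : realType) (n q : nat) (W : 'M[R]_(n, q))
    (x : 'cV[R]_n) : 'cV[R]_n :=
  (x^T *m proj_mx <<W^T>>%MS (kermx W))^T.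

Lemma trmx_self_eq0 (R : realType) (n : nat) (u : 'rV[R]_n) :
  u *m u^T = 0 -> u = 0.
Proof.
move=> /matrixP/(_ 0 0); rewrite !mxE => /eqP.
rewrite psumr_eq0 => [/allP u0|i _]; last by rewrite mxE -expr2 sqr_ge0.
apply/rowP => i; have /implyP/(_ isT) := u0 i (mem_index_enum i).
by rewrite !mxE mulf_eq0 orbb => /eqP.
Qed.

Lemma capmx_ran_ker (R : realType) (n q : nat) (W : 'M[R]_(n, q)) :
  (<<W^T>> :&: kermx W = 0)%MS.
Proof.
apply/eqP/rowV0P => u; rewrite sub_capmx genmxE => /andP[/submxP[v uE]].
move=> /sub_kermxP uW; apply: trmx_self_eq0.
by rewrite {2}uE trmx_mul trmxK mulmxA uW mul0mx.
Qed.

(* orthproj W x is the unique p in ran(W) with x - p orthogonal to ran(W). *)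
Lemma orthprojP (R : realType) (n q : nat) (W : 'M[R]_(n, q))
    (x p : 'cV[R]_n) :
  p = orthproj W x <-> (exists c : 'cV[R]_q, p = W *m c) /\ W^T *m (x - p) = 0.
Proof.
have dx := capmx_ran_ker W; split=> [->|[[c ->] Wxp]]; last first.
  apply: trmx_inj; rewrite /orthproj trmxK -[in RHS](subrK (W *m c) x).
  rewrite linearD /= mulmxDl proj_mx_0 // ?add0r; last first.
    by apply/sub_kermxP/trmx_inj; rewrite trmx_mul trmxK Wxp trmx0.
  by rewrite proj_mx_id // genmxE trmx_mul submxMl.
have sx : (x^T <= <<W^T>> + kermx W)%MS.
  apply: submx_full; rewrite /row_full mxrank_disjoint_sum // genmxE.
  by rewrite mxrank_tr mxrank_ker subnKC // rank_leq_row.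
split.
  have := proj_mx_sub <<W^T>>%MS (kermx W) x^T.
  rewrite genmxE => /submxP[D ED]; exists D^T.
  by rewrite /orthproj ED trmx_mul trmxK.
have /sub_kermxP E := proj_mx_compl_sub sx.
by apply: trmx_inj; rewrite trmx_mul trmxK linearB /= trmxK E trmx0.
Qed.

Definition rowblock (R : realType) (m n : nat) (A : 'M[R]_(m, n))
    (B : {set 'I_m}) : 'M[R]_(#|B|, n) :=
  rowsub (fun j : 'I_#|B| => enum_val j) A.

Definition AP_step (R : realType) (m n k : nat) (A : 'M[R]_(m, n))
    (B : 'I_k -> {set 'I_m}) (x p : 'cV[R]_n) (i : 'I_k) : 'cV[R]_n :=
  orthproj (row_mx p (rowblock A (B i))^T) x.

(* enum 'I_k lists the block indices in increasing order. *)
Definition AP_sweep (R : realType) (m n k : nat) (A : 'M[R]_(m, n))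
    (B : 'I_k -> {set 'I_m}) (x p0 : 'cV[R]_n) : 'cV[R]_n :=
  foldl (AP_step A B x) p0 (enum 'I_k).

Definition SAP_init (R : realType) (m n : nat) (A : 'M[R]_(m, n))
    (b : 'cV[R]_m) : 'cV[R]_n :=
  (enorm b ^+ 2 / enorm (A^T *m b) ^+ 2) *: (A^T *m b).

Definition SAP (R : realType) (m n k : nat) (A : 'M[R]_(m, n))
    (B : 'I_k -> {set 'I_m}) (x : 'cV[R]_n) (b : 'cV[R]_m) (s : nat) :
    'cV[R]_n :=
  iter s (AP_sweep A B x) (SAP_init A b).

(* Main.v *)
(** Every iterate [p] lies in ran(A') and satisfies [<p, x - p> = 0]. For two
    such vectors with [<p, x - q> = 0] this gives [<p, q - p> = 0], hence
    [|q|^2 = |p|^2 + |q - p|^2]. So the norm grows at each projection step,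
    strictly unless the step is stationary. A sweep that keeps the norm has only
    stationary steps; then [A_i (x - p) = 0] for all [i], and as the blocks cover
    all rows, [p] is the projection of [x] onto ran(A'). The last inequality is
    the same identity with [q] that projection. *)
Require Import Defs.
From HB Require Import structures.
From mathcomp Require Import all_boot all_order all_algebra.
From mathcomp Require Import reals.
Set Implicit Arguments.
Unset Strict Implicit.
Unset Printing Implicit Defensive.
Import Order.TTheory GRing.Theory Num.Theory.
Local Open Scope ring_scope.

Lemma enorm_ge0 (R : realType) (n : nat) (v : 'cV[R]_n) : 0 <= enorm v.
Proof. exact: sqrtr_ge0. Qed.

Lemma mulmx_tr_enorm (R : realType) (n : nat) (v : 'cV[R]_n) :
  v^T *m v = (enorm v ^+ 2)%:M.
Proof.
rewrite [LHS]mx11_scalar sqr_sqrtr; last first.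
  by apply: sumr_ge0 => i _; exact: sqr_ge0.
by congr _%:M; rewrite mxE; apply: eq_bigr => i _; rewrite mxE expr2.
Qed.

Lemma enorm_eq0 (R : realType) (n : nat) (v : 'cV[R]_n) :
  (enorm v == 0) = (v == 0).
Proof.
apply/eqP/eqP => [v0|->]; last first.
  by rewrite /enorm big1 ?sqrtr0 // => i _; rewrite mxE expr0n.
apply: trmx_inj; rewrite trmx0; apply: trmx_self_eq0.
by rewrite trmxK mulmx_tr_enorm v0 expr0n raddf0.
Qed.

Lemma enorm_pythagoras (R : realType) (n : nat) (p q : 'cV[R]_n) :
  p^T *m (q - p) = 0 -> enorm q ^+ 2 = enorm p ^+ 2 + enorm (q - p) ^+ 2.
Proof.
move: (q - p) (subrK p q) => d <- pd.
have dp : d^T *m p = 0 by apply: trmx_inj; rewrite trmx_mul trmxK pd trmx0.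
have /(congr1 (fun M : 'M_1 => M 0 0)) := mulmx_tr_enorm (d + p).
rewrite [(d + p)^T]linearD /= mulmxDl !mulmxDr pd dp addr0 add0r.
by rewrite !mulmx_tr_enorm !mxE !mulr1n addrC => <-.
Qed.

(** By Pythagoras the squared norms differ by [|q - p|^2], which vanishes only for [q = p]. The
    equality case later turns a constant norm into a stationary step. *)
Lemma enorm_le_orth (R : realType) (n : nat) (p q : 'cV[R]_n) :
  p^T *m (q - p) = 0 -> enorm p <= enorm q ?= iff (q == p).
Proof.
move=> /enorm_pythagoras pq; split.
  by rewrite -ler_sqr ?nnegrE ?enorm_ge0 // pq lerDl sqr_ge0.
rewrite -[q == p]subr_eq0 -enorm_eq0 -[RHS](expf_eq0 _ 2).
by rewrite -(@eqrXn2 _ 2) ?enorm_ge0 // pq eq_sym addrC -subr_eq0 addrK.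
Qed.

(** The invariant of the iteration. Its second half places [p] on the sphere with diameter from 0 to
    [x]. *)
Definition ran_orth (R : realType) (m n : nat) (A : 'M[R]_(m, n))
    (x p : 'cV[R]_n) : Prop :=
  (exists c, p = A^T *m c) /\ p^T *m (x - p) = 0.

(** With [v = A^T b], [<v, x> = <b, A x> = |b|^2], so the scaling factor is the one that projects
    [x] onto the line of [v]. *)
Lemma ran_orth_init (R : realType) (m n : nat) (A : 'M[R]_(m, n))
    (x : 'cV[R]_n) (b : 'cV[R]_m) :
  A *m x = b -> ran_orth A x (SAP_init A b).
Proof.
move=> Axb; rewrite /SAP_init; set v := A^T *m b; split.
  by exists ((enorm b ^+ 2 / enorm v ^+ 2) *: b); rewrite -scalemxAr.
rewrite linearZ /= -scalemxAl mulmxBr -scalemxAr.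
have -> : v^T *m x = b^T *m b by rewrite trmx_mul trmxK -mulmxA Axb.
(* For [v = 0] the quotient takes the default value 0, and the claim is trivial. *)
rewrite !mulmx_tr_enorm; have [->|v0] := eqVneq (enorm v ^+ 2) 0.
  by rewrite invr0 mulr0 scale0r.
by rewrite scale_scalar_mx divfK // subrr scaler0.
Qed.

(** The normal equations for [[p, A_i']] split into [<p, x - q> = 0] and [A_i (x - q) = 0]; the
    former is subtracted from [<p, x - p> = 0]. *)
Lemma AP_stepP (R : realType) (m n k : nat) (A : 'M[R]_(m, n))
    (B : 'I_k -> {set 'I_m}) (x p : 'cV[R]_n) (i : 'I_k)
    (q := AP_step A B x p i) :
  ran_orth A x p ->
  [/\ ran_orth A x q, p^T *m (q - p) = 0 & rowblock A (B i) *m (x - q) = 0].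
Proof.
move=> [[c pE] px]; have /orthprojP[[d qE]] : q = orthproj _ x := erefl.
rewrite tr_row_mx trmxK mul_col_mx -[RHS]col_mx0.
move=> /eq_col_mx[pq Bq]; split=> //; last first.
  by rewrite -(subrKA x) addrC mulmxDr px -opprB mulmxN pq oppr0 addr0.
split.
  (* A row block is [S A] with [S] a selection matrix, so its transpose factors through [A^T]. *)
  rewrite qE -[d]vsubmxK mul_row_col pE /rowblock rowsubE trmx_mul -!mulmxA.
  by rewrite -mulmxDr; eexists.
rewrite {1}qE trmx_mul -mulmxA tr_row_mx trmxK mul_col_mx pq Bq.
by rewrite col_mx0 mulmx0.
Qed.

Lemma foldl_AP_step (R : realType) (m n k : nat) (A : 'M[R]_(m, n))
    (B : 'I_k -> {set 'I_m}) (x p : 'cV[R]_n) (s : seq 'I_k)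
    (q := foldl (AP_step A B x) p s) :
  ran_orth A x p ->
  [/\ ran_orth A x q, enorm p <= enorm q &
      enorm q <= enorm p ->
      forall i, i \in s -> rowblock A (B i) *m (x - p) = 0].
Proof.
rewrite {}/q; elim: s p => [|i s IHs] p pP /=; first by split.
have [p1P pp1 Bp1] := AP_stepP B i pP.
have [qP p1q IH] := IHs _ p1P; have pp1_le := enorm_le_orth pp1.
split=> // [|qp]; first exact: le_trans pp1_le p1q.
(* The first step is squeezed: its norm is at most [|q|], hence at most [|p|]. So the residuals of
   later blocks are also taken at [p]. *)
have /eqP p1E : AP_step A B x p i == p.
  by rewrite -(ge_leif pp1_le); apply: le_trans p1q qp.
rewrite p1E in Bp1 IH qp *; move=> j; rewrite inE => /predU1P[->//|].
exact: IH.
Qed.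

Lemma rowblock_cover_eq0 (R : realType) (m n k : nat) (A : 'M[R]_(m, n))
    (B : 'I_k -> {set 'I_m}) (v : 'cV[R]_n) :
  (forall r, exists i, r \in B i) ->
  (forall i, rowblock A (B i) *m v = 0) -> A *m v = 0.
Proof.
move=> cover Bv; apply/matrixP => r j; have [i ri] := cover r.
have /matrixP/(_ (enum_rank_in ri r) j) := Bv i; rewrite !mxE => Bvr.
by rewrite -[RHS]Bvr; apply: eq_bigr => l _; rewrite mxE enum_rankK_in.
Qed.

Lemma ran_orth_sweep (R : realType) (m n k : nat) (A : 'M[R]_(m, n))
    (B : 'I_k -> {set 'I_m}) (x p : 'cV[R]_n) :
  ran_orth A x p -> ran_orth A x (AP_sweep A B x p).
Proof. by move=> /(foldl_AP_step B (enum 'I_k))[]. Qed.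

Lemma enorm_lt_sweep (R : realType) (m n k : nat) (A : 'M[R]_(m, n))
    (B : 'I_k -> {set 'I_m}) (x p : 'cV[R]_n) :
  (forall r, exists i, r \in B i) ->
  ran_orth A x p -> p != orthproj A^T x ->
  enorm p < enorm (AP_sweep A B x p).
Proof.
move=> cover pP; apply: contraNT; rewrite -leNgt => le_qp; apply/eqP/orthprojP.
split; first by case: pP.
have [_ _ Bp] := foldl_AP_step B (enum 'I_k) pP.
rewrite trmxK; apply: rowblock_cover_eq0 cover _ => i.
by apply: Bp le_qp _ _; rewrite mem_enum.
Qed.

(** Since [p] lies in ran(A'), it is orthogonal to [x - y], and by the invariant to [x - p], hence
    to [y - p]. *)
Lemma enorm_lt_orthproj (R : realType) (m n : nat) (A : 'M[R]_(m, n))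
    (x p : 'cV[R]_n) :
  ran_orth A x p -> p != orthproj A^T x -> enorm p < enorm (orthproj A^T x).
Proof.
move=> [[c pE] px]; set y := orthproj A^T x => py.
have /orthprojP[_] : y = orthproj A^T x := erefl.
rewrite trmxK => Axy.
have pxy : p^T *m (x - y) = 0 by rewrite pE trmx_mul trmxK -mulmxA Axy mulmx0.
rewrite (lt_leif (enorm_le_orth _)) 1?eq_sym //.
by rewrite -(subrKA x) addrC mulmxDr px -opprB mulmxN pxy oppr0 addr0.
Qed.

Theorem theorem3p6 (R : realType) (m n k t : nat) (A : 'M[R]_(m, n))
    (B : 'I_k -> {set 'I_m}) (x : 'cV[R]_n) (b : 'cV[R]_m)
    (hmn : (m <= n)%N)
    (hcover : forall r : 'I_m, exists i : 'I_k, r \in B i)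
    (hb : b != 0)
    (hAx : A *m x = b)
    (ht : (1 <= t)%N)
    (hconv : forall s : nat, (1 <= s <= t)%N ->
       SAP A B x b s != orthproj A^T x) :
  (forall s : nat, (1 <= s < t)%N ->
     enorm (SAP A B x b s) < enorm (SAP A B x b s.+1)) /\
  enorm (SAP A B x b t) < enorm (orthproj A^T x).
Proof.
(* The induction starts at the initial vector, index 0, one before the first index compared. *)
have SAP_orth s : ran_orth A x (SAP A B x b s).
  elim: s => [|s IHs]; first exact: ran_orth_init.
  by rewrite /SAP iterS; apply: ran_orth_sweep.
split=> [s /andP[s1 st]|].
  by rewrite {2}/SAP iterS; apply: enorm_lt_sweep; rewrite // hconv // s1 ltnW.
by apply: enorm_lt_orthproj; rewrite // hconv // ht leqnn.
Qed.
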